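(* Let $1<c_2<c_3<c_4<c_5$ be natural numbers. The coin system $\$_1=\langle 1,c_2,c_3,c_4\rangle$ is non-canonical and the coin system $\$_2=\langle 1,c_2,c_3,c_4,c_5\rangle$ is canonical if and only if $c_3>3$ and $\$_2=\langle 1,2,c_3,c_3+1,2c_3\rangle$ (i.e. $c_2=2$, $c_4=c_3+1$, $c_5=2c_3$).
   Context: A coin system is a tuple $\langle c_1,\dots,c_m\rangle$ of natural numbers with $1=c_1<c_2<\cdots<c_m$. A representation of $x$ is a tuple $(\alpha_1,\dots,\alpha_m)$ of natural numbers with $\sum_i\alpha_ic_i=x$, of size $\sum_i\alpha_i$. The greedy representation $\mathrm{GRD}(x)$ is the representation with $\sum_{j<i}\alpha_jc_j<c_i$ for all $2\le i\le m$; $\mathrm{OPT}(x)$ is a representation of minimum size. The system is canonical if $|\mathrm{GRD}(x)|=|\mathrm{OPT}(x)|$ for all $x$, and non-canonical otherwise. *)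

(* Defs.v *)
From mathcomp Require Import all_boot.

Set Implicit Arguments.
Unset Strict Implicit.
Unset Printing Implicit Defensive.

(* Indices are 0-based: the coin written c_i in the usual 1-based notation is
   [tnth c] at i - 1. *)
Definition coin_system (m : nat) (c : m.-tuple nat) : bool :=
  (head 0 c == 1) && sorted ltn c.

Definition is_rep (m : nat) (c : m.-tuple nat) (x : nat) (a : m.-tuple nat) :
  Prop := \sum_(i < m) tnth a i * tnth c i = x.

Definition rep_size (m : nat) (a : m.-tuple nat) : nat :=
  \sum_(i < m) tnth a i.

(* GRD(x) and OPT(x) are rendered as relations between x and a representation;
   [GRD_exists], [GRD_unique] and [OPT_exists] below show that the first is
   functional, and both total, on coin systems. *)
Definition is_GRD (m : nat) (c : m.-tuple nat) (x : nat) (a : m.-tuple nat) :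
  Prop :=
  is_rep c x a /\
  forall i : 'I_m, 0 < i ->
    \sum_(j < m | j < i) tnth a j * tnth c j < tnth c i.

Definition is_OPT (m : nat) (c : m.-tuple nat) (x : nat) (a : m.-tuple nat) :
  Prop :=
  is_rep c x a /\ forall b : m.-tuple nat, is_rep c x b ->
    rep_size a <= rep_size b.

Definition canonical_system (m : nat) (c : m.-tuple nat) : Prop :=
  forall (x : nat) (g o : m.-tuple nat),
    is_GRD c x g -> is_OPT c x o -> rep_size g = rep_size o.

Lemma is_rep_nat (m : nat) (c a : m.-tuple nat) (x : nat) :
  is_rep c x a <-> \sum_(0 <= j < m) nth 0 a j * nth 0 c j = x.
Proof.
rewrite /is_rep big_mkord.
by under eq_bigr => i _ do rewrite !(tnth_nth 0).
Qed.

Lemma partial_sum_nat (m : nat) (c a : m.-tuple nat) (i : 'I_m) :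
  \sum_(j < m | j < i) tnth a j * tnth c j =
  \sum_(0 <= j < i) nth 0 a j * nth 0 c j.
Proof.
rewrite big_mkord (big_ord_widen_cond m xpredT
  (fun j => nth 0 a j * nth 0 c j)) ?(ltnW (ltn_ord i)) //.
by apply: eq_bigr => j _; rewrite !(tnth_nth 0).
Qed.

Lemma is_GRD_nat (m : nat) (c a : m.-tuple nat) (x : nat) :
  is_GRD c x a <->
  \sum_(0 <= j < m) nth 0 a j * nth 0 c j = x /\
  (forall i, 0 < i < m ->
    \sum_(0 <= j < i) nth 0 a j * nth 0 c j < nth 0 c i).
Proof.
rewrite /is_GRD; split=> [][/is_rep_nat Hr Hg]; split=> //.
- move=> i /andP[i0 im]; have := Hg (Ordinal im) i0.
  by rewrite partial_sum_nat (tnth_nth 0).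
- move=> i i0; rewrite partial_sum_nat (tnth_nth 0); apply: Hg.
  by rewrite i0 ltn_ord.
Qed.

Lemma coin_system_size (m : nat) (c : m.-tuple nat) : coin_system c -> 0 < m.
Proof. by case: m c => // c; rewrite (tuple0 c). Qed.

Lemma coin_gt0 (m : nat) (c : m.-tuple nat) (i : nat) :
  coin_system c -> i < m -> 0 < nth 0 c i.
Proof.
case/andP=> /eqP c1 cs im; have m0 : 0 < m by apply: leq_ltn_trans im.
have c0 : nth 0 c 0 = 1 by rewrite nth0.
case: i im => [|i] im; first by rewrite c0.
rewrite -[X in X <= _]c0 ltnW //.
by apply: (sorted_ltn_nth ltn_trans) => //; rewrite inE size_tuple.
Qed.

Lemma GRD_exists (m : nat) (c : m.-tuple nat) (x : nat) :
  coin_system c -> exists a, is_GRD c x a.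
Proof.
move=> cs; have m0 := coin_system_size cs.
have c0 : nth 0 c 0 = 1 by case/andP: cs => /eqP; rewrite nth0.
suff [f [fx fg]] : exists f : nat -> nat,
    \sum_(0 <= j < m) f j * nth 0 c j = x /\
    (forall i, 0 < i < m -> \sum_(0 <= j < i) f j * nth 0 c j < nth 0 c i).
  have nthf j : j < m -> nth 0 [tuple f (val i) | i < m] j = f j.
    by move=> jm; rewrite -[j]/(val (Ordinal jm)) -tnth_nth tnth_mktuple.
  have sumf k : k <= m ->
      \sum_(0 <= j < k) nth 0 [tuple f (val i) | i < m] j * nth 0 c j =
      \sum_(0 <= j < k) f j * nth 0 c j.
    move=> km; apply: eq_big_nat => j /andP[_ jk].
    by rewrite nthf // (leq_trans jk).
  exists [tuple f (val i) | i < m]; apply/is_GRD_nat.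
  rewrite sumf //; split=> // i /andP[i0 im].
  by rewrite sumf ?(ltnW im) //; apply: fg; rewrite i0.
have: forall n, 0 < n <= m -> forall x, exists f : nat -> nat,
    \sum_(0 <= j < n) f j * nth 0 c j = x /\
    (forall i, 0 < i < n -> \sum_(0 <= j < i) f j * nth 0 c j < nth 0 c i).
  elim=> // -[|p] IHp pm {}x.
    exists (fun=> x); rewrite big_nat1 c0 muln1; split=> // i.
    by case: i => [|[]].
  have [f [fx fg]] := IHp (ltnW pm) (x %% nth 0 c p.+1).
  pose g j := if j == p.+1 then x %/ nth 0 c p.+1 else f j.
  have gf i : i <= p.+1 ->
      \sum_(0 <= j < i) g j * nth 0 c j = \sum_(0 <= j < i) f j * nth 0 c j.
    move=> ip; apply: eq_big_nat => j /andP[_ ji].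
    by rewrite /g ltn_eqF // (leq_trans ji).
  exists g; split.
    by rewrite big_nat_recr //= gf // fx {1}/g eqxx addnC -divn_eq.
  move=> i /andP[i0]; rewrite ltnS leq_eqVlt => /orP[/eqP->|ip].
    by rewrite gf // fx ltn_mod coin_gt0.
  by rewrite gf ?(ltnW ip) // fg // i0.
by apply; rewrite m0 leqnn.
Qed.

Lemma GRD_unique (m : nat) (c : m.-tuple nat) (x : nat) (a b : m.-tuple nat) :
  coin_system c -> is_GRD c x a -> is_GRD c x b -> a = b.
Proof.
move=> cs /is_GRD_nat[ax ag] /is_GRD_nat[bx bg].
have c0 : nth 0 c 0 = 1 by case/andP: cs => /eqP; rewrite nth0.
have H n : n <= m ->
    \sum_(0 <= j < n) nth 0 a j * nth 0 c j =
    \sum_(0 <= j < n) nth 0 b j * nth 0 c j ->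
    forall j, j < n -> nth 0 a j = nth 0 b j.
  elim: n => // n IH nm; rewrite !big_nat_recr //=.
  case: n => [|n] in IH nm *.
    by rewrite !big_geq // c0 !muln1 !add0n => E [].
  set A := \sum_(_ <= _ < _) _; set B := \sum_(_ <= _ < _) _ => E.
  have cp := coin_gt0 cs nm.
  have hA : A < nth 0 c n.+1 by apply: ag.
  have hB : B < nth 0 c n.+1 by apply: bg.
  have AB : A = B.
    by rewrite -(modn_small hA) -(modn_small hB) -(modnMDl (nth 0 a n.+1) A)
      -(modnMDl (nth 0 b n.+1) B) addnC E addnC.
  move=> j; rewrite ltnS leq_eqVlt => /orP[/eqP->|jn]; last first.
    by apply: IH => //; apply: ltnW.
  by move/eqP: E; rewrite AB eqn_add2l eqn_pmul2r // => /eqP.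
apply/val_inj/(@eq_from_nth _ 0); rewrite ?size_tuple // => i im.
by apply: (H m) => //; rewrite ax.
Qed.

Lemma OPT_exists (m : nat) (c : m.-tuple nat) (x : nat) :
  coin_system c -> exists a, is_OPT c x a.
Proof.
move=> cs; have [g [gx _]] := GRD_exists x cs.
pose nat_of (t : m.-tuple 'I_x.+1) : m.-tuple nat := map_tuple val t.
have ofE b : is_rep c x b -> exists t, b = nat_of t.
  move=> bx; exists [tuple inord (tnth b i) | i < m].
  apply: eq_from_tnth => i; rewrite tnth_map tnth_mktuple /= inordK // ltnS.
  rewrite -bx (bigD1 i) //=; apply: leq_trans (leq_addr _ _).
  by rewrite leq_pmulr // (tnth_nth 0) coin_gt0.
have [t0 g0] := ofE _ gx.
pose P t := \sum_(i < m) tnth (nat_of t) i * tnth c i == x.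
have P0 : P t0 by rewrite /P -g0; apply/eqP.
case: (arg_minnP (fun t => rep_size (nat_of t)) P0) => t /eqP tx tmin.
exists (nat_of t); split=> // b bx.
have [u bu] := ofE _ bx; rewrite bu; apply: tmin.
by rewrite /P -bu; apply/eqP.
Qed.

(* Main.v *)
Require Import Defs.
From mathcomp Require Import all_boot.
From mathcomp Require Import zify.

(** A system is canonical iff its greedy size G satisfies G(x + d) <= G(x) + 1
for all x and all coins d, and for a system with largest coins c < c' it
suffices to check x + d < c + c' (Kozen and Zaks). The greedy sizes of the
four-coin and five-coin systems agree below c5, so only the values in
[c5, c3 + c4) can separate them. If this interval is nonempty, then the values
c3 + c4 and 2 c4 exceed c5 by less than c4 and have two-coin representations,
so c3 + c4 - c5 is 1 or c2, and 2 c4 - c5 is c2 or c3. The few resulting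
systems are all canonical on four coins, except <1, 2, c3, c3 + 1, 2 c3> with
c3 > 3. *)

(** * Greedy sizes for a list of coins *)

(* The size of the greedy representation; the coins [s] are listed in decreasing
order. *)
Fixpoint greedy (s : seq nat) (x : nat) : nat :=
  if s is c :: s' then x %/ c + greedy s' (x %% c) else 0.

Definition subadditive_on (s : seq nat) : Prop :=
  forall x d, d \in s -> greedy s (x + d) <= (greedy s x).+1.

Lemma greedy0 (s : seq nat) : greedy s 0 = 0.
Proof. by elim: s => //= c s IH; rewrite div0n mod0n IH. Qed.

Lemma greedy_unit (x : nat) : greedy [:: 1] x = x.
Proof. by rewrite /= divn1 addn0. Qed.

Lemma greedy_small (c : nat) (s : seq nat) (x : nat) :
  x < c -> greedy (c :: s) x = greedy s x.
Proof. by move=> xc; rewrite /= divn_small // modn_small. Qed.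

Lemma greedy_head (c : nat) (s : seq nat) (x : nat) :
  0 < c -> greedy (c :: s) (x + c) = (greedy (c :: s) x).+1.
Proof. by move=> c0; rewrite /= divnDr // divnn c0 modnDr addn1. Qed.

Lemma greedy_divn (c : nat) (s : seq nat) (q r : nat) :
  r < c -> greedy (c :: s) (q * c + r) = q + greedy s r.
Proof.
move=> rc; have c0 : 0 < c by apply: leq_ltn_trans rc.
by rewrite /= divnMDl // modnMDl divn_small ?modn_small ?addn0.
Qed.

(** The last coin 1 matters: [greedy] discards whatever remainder the last coin leaves. *)
Lemma greedy_eq0 (s : seq nat) (x : nat) : greedy (rcons s 1) x = 0 -> x = 0.
Proof.
elim: s x => [|c s IH] x; first by rewrite greedy_unit.
move/eqP; rewrite /= addn_eq0 => /andP[/eqP q0 /eqP/IH r0].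
by rewrite (divn_eq x c) q0 r0.
Qed.

Lemma greedy_le1 (s : seq nat) (x : nat) :
  greedy (rcons s 1) x <= 1 -> (x == 0) || (x \in rcons s 1).
Proof.
elim: s x => [|c s IH] x; first by rewrite greedy_unit inE; case: x => [|[]].
rewrite /= inE; have [q0|qp] := posnP (x %/ c).
  have -> : x %% c = x by rewrite {2}(divn_eq x c) q0.
  by rewrite q0 => /IH /orP[->//|->]; rewrite !orbT.
move=> g1; have q1 : x %/ c = 1 by lia.
have /greedy_eq0 r0 : greedy (rcons s 1) (x %% c) = 0 by lia.
by rewrite {2}(divn_eq x c) q1 r0 addn0 mul1n eqxx orbT.
Qed.

(** * Canonicity as subadditivity *)

(** The greedy condition makes each coefficient the quotient, and the partial sum before it the
    remainder, of division by that coin. *)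
Lemma is_GRD_size (m : nat) (c a : m.-tuple nat) (x : nat) :
  coin_system c -> is_GRD c x a -> rep_size a = greedy (rev c) x.
Proof.
move=> cs /is_GRD_nat[ax ag].
have c0 : nth 0 c 0 = 1 by case/andP: cs => /eqP; rewrite nth0.
have H n : n <= m -> \sum_(0 <= j < n) nth 0 a j =
    greedy (rev (take n c)) (\sum_(0 <= j < n) nth 0 a j * nth 0 c j).
  elim: n => [|n IH] nm; first by rewrite take0 !big_geq.
  rewrite (take_nth 0) ?size_tuple // rev_rcons !big_nat_recr //=.
  set A := \sum_(_ <= _ < _) _ * _.
  have cp := coin_gt0 cs nm.
  have hA : A < nth 0 c n.
    case: n @A nm {IH cp} => [|n] A nm; first by rewrite /A big_geq // c0.
    exact: ag.
  by rewrite addnC [A + _]addnC divnMDl // divn_small // modnMDl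
    modn_small // addn0 IH // ltnW.
have := H m (leqnn m); rewrite ax take_oversize ?size_tuple // => <-.
rewrite /rep_size big_mkord; apply: eq_bigr => i _.
exact: tnth_nth.
Qed.

Lemma subadditive_le_rep (m : nat) (c a : m.-tuple nat) (x : nat) :
  subadditive_on (rev c) -> is_rep c x a -> greedy (rev c) x <= rep_size a.
Proof.
move=> sub <-.
(* An arbitrary starting value y lets the bounds for successive coins compose. *)
suff H y : greedy (rev c) (y + \sum_(i < m) tnth a i * tnth c i) <=
    greedy (rev c) y + rep_size a by have := H 0; rewrite greedy0.
rewrite /rep_size; move: y; elim/big_ind2: _ => [y|u u' v v' Hu Hv y|i _ y].
- by rewrite !addn0.
- by rewrite !addnA; apply: leq_trans (Hv _) _; rewrite leq_add2r.
elim: (tnth a i) => [|k IH]; first by rewrite !addn0.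
rewrite mulSn [tnth c i + _]addnC addnA addnS; apply: leq_trans (sub _ _ _) _ => //.
by rewrite mem_rev mem_tnth.
Qed.

(** One more coin d turns the greedy representation of x into some representation of x + d, which
    cannot beat the optimum. Conversely, building any representation coin by coin bounds the greedy
    size by its size. *)
Lemma canonicalP (m : nat) (c : m.-tuple nat) :
  coin_system c -> canonical_system c <-> subadditive_on (rev c).
Proof.
move=> cs; split=> [can x d|sub x g o gx [ox omin]]; last first.
  apply/eqP; rewrite eqn_leq [X in _ && X]omin; last by case: gx.
  by rewrite (is_GRD_size _ _ _ _ cs gx) (subadditive_le_rep _ _ _ _ sub ox).
rewrite mem_rev => /tnthP[i ->].
have [a ax] := GRD_exists x cs; have [g gx] := GRD_exists (x + tnth c i) cs.
have [o ox] := OPT_exists (x + tnth c i) cs.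
rewrite -(is_GRD_size _ _ _ _ cs ax) -(is_GRD_size _ _ _ _ cs gx).
rewrite (can _ _ _ gx ox).
pose b := [tuple tnth a j + (j == i) | j < m].
have -> : (rep_size a).+1 = rep_size b.
  rewrite /rep_size; under [RHS]eq_bigr => j _ do rewrite tnth_mktuple.
  rewrite big_split /= -addn1; congr (_ + _).
  by rewrite (bigD1 i) //= eqxx big1 // => j /negbTE->.
apply: (proj2 ox); rewrite /is_rep.
under eq_bigr => j _ do rewrite tnth_mktuple mulnDl.
case: ax => <- _; rewrite big_split /=; congr (_ + _).
rewrite (bigD1 i) //= eqxx mul1n big1 ?addn0 // => j /negbTE->.
by rewrite mul0n.
Qed.

(* If x + d >= e + c, then the greedy representations of x and x + d both use
the largest coin c, which can be removed from both. *)
Lemma subadditive_bound (c e : nat) (s : seq nat) :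
  0 < c -> {in s, forall d, d <= e} ->
  (forall x d, d \in s -> x + d < e + c ->
    greedy (c :: s) (x + d) <= (greedy (c :: s) x).+1) ->
  subadditive_on (c :: s).
Proof.
move=> c0 se H x d; rewrite inE => /predU1P[->|ds]; first by rewrite greedy_head.
elim/ltn_ind: x => x IH; have [/H->//|le] := ltnP (x + d) (e + c).
have de := se d ds; have cx : c <= x by lia.
by rewrite -(subnK cx) addnAC !greedy_head // ltnS IH //; lia.
Qed.

(* If the greedy algorithm takes the coin c from a sum of two coins, the rest has
greedy size at most 1. *)
Lemma two_coins (s : seq nat) (a b c x : nat) :
  subadditive_on (rcons s 1) -> a \in rcons s 1 -> b \in rcons s 1 ->
  a + b = x + c -> greedy (rcons s 1) (x + c) = (greedy (rcons s 1) x).+1 ->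
  (x == 0) || (x \in rcons s 1).
Proof.
move=> sub sa sb E gx; apply: greedy_le1.
have := sub a b sb; have := sub 0 a sa; rewrite greedy0 add0n E gx.
lia.
Qed.

(** * The four-coin and five-coin systems *)

Lemma special_of_noncanonical_prefix (c2 c3 c4 c5 : nat) :
  1 < c2 -> c2 < c3 -> c3 < c4 -> c4 < c5 ->
  subadditive_on [:: c5; c4; c3; c2; 1] ->
  ~ subadditive_on [:: c4; c3; c2; 1] ->
  [/\ 3 < c3, c2 = 2, c4 = c3 + 1 & c5 = 2 * c3].
Proof.
move=> h2 h3 h4 h5 sub5 nsub4.
have [//|nspecial] := boolP [&& 3 < c3, c2 == 2, c4 == c3 + 1 & c5 == 2 * c3].
  by case/and4P=> ? /eqP ? /eqP ? /eqP ?.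
case: nsub4; apply: (@subadditive_bound c4 c3); first lia.
  by move=> d; rewrite !inE; lia.
move=> x d dS bound.
pose s5 := [:: c5; c4; c3; c2; 1].
have two a b c y : a \in s5 -> b \in s5 -> a + b = y + c ->
    greedy s5 (y + c) = (greedy s5 y).+1 -> (y == 0) || (y \in s5).
  exact: (two_coins [:: c5; c4; c3; c2]).
have step5 y := greedy_head c5 [:: c4; c3; c2; 1] y ltac:(lia).
have low5 y := greedy_small c5 [:: c4; c3; c2; 1] y.
have g2_low y : y < c2 -> greedy [:: c2; 1] y = y.
  by move=> yc; rewrite greedy_small // greedy_unit.
have g2_step z y : z = y + c2 -> greedy [:: c2; 1] z = (greedy [:: c2; 1] y).+1.
  by move=> ->; rewrite greedy_head //; lia.
have g4_low y : y < c3 -> greedy [:: c4; c3; c2; 1] y = greedy [:: c2; 1] y.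
  by move=> yc; rewrite (greedy_small c4) ?(greedy_small c3) //; lia.
have g4_c3 z y : z = y + c3 -> y < c3 -> z < c4 ->
    greedy [:: c4; c3; c2; 1] z = (greedy [:: c2; 1] y).+1.
  by move=> -> yc zc; rewrite greedy_small // greedy_head ?(greedy_small c3) //; lia.
have g4_c4 z y : z = y + c4 -> y < c3 ->
    greedy [:: c4; c3; c2; 1] z = (greedy [:: c2; 1] y).+1.
  by move=> -> yc; rewrite greedy_head ?g4_low //; lia.
have sub2 y : y.+1 < c3 -> greedy [:: c2; 1] y.+1 <= (greedy [:: c2; 1] y).+1.
  move=> yc; rewrite -!g4_low -?low5 -?[y.+1]addn1; try lia.
  by apply: sub5; rewrite !inE eqxx !orbT.
have [lt5|ge5] := ltnP (x + d) c5.
  rewrite -(low5 (x + d)) // -(low5 x); last by lia.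
  by apply: sub5; rewrite in_cons in_cons dS !orbT.
(* As c5 <= x + d < c3 + c4 and c4 < c5, the rest lies strictly between 0 and c3. *)
have r_coin : c3 + c4 = c5 + 1 \/ c3 + c4 = c5 + c2.
  have Er : c3 + c4 = c3 + c4 - c5 + c5 by lia.
  have := two c3 c4 c5 _ _ _ Er (step5 _).
  by rewrite !inE !eqxx !orbT => /(_ isT isT); lia.
have s_coin : 2 * c4 = c5 + c2 \/ 2 * c4 = c5 + c3.
  have Es : c4 + c4 = c4 + c4 - c5 + c5 by lia.
  have := two c4 c4 c5 _ _ _ Es (step5 _).
  by rewrite !inE !eqxx !orbT => /(_ isT isT); lia.
have {}dS : [\/ d = c3, d = c2 | d = 1].
  by move: dS; rewrite !inE => /or3P[] /eqP->; constructor.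
have dc3 : d <= c3 by case: dS => ->; lia.
(* Here c5 is the only value to check. *)
case: r_coin => Er.
  have Ex : x + d = c5 by lia.
  case: s_coin => Es.
    have E4 : c4 = c3 + c2 - 1 by lia.
    have E5 : c5 = c3 + c3 + c2 - 2 by lia.
    have [c22|c2n2] := eqVneq c2 2.
      have c33 : c3 = 3 by lia.
      have -> : greedy [:: c4; c3; c2; 1] (x + d) = 2.
        rewrite (g4_c4 _ c2); [|lia|lia].
        by rewrite (g2_step _ 0) // g2_low; lia.
      rewrite ltnS lt0n; apply/eqP=> g0.
      have := greedy_eq0 [:: c4; c3; c2] x g0; lia.
    (* As c2 > 2, the value 2 c3 is below c5, so greedy takes c4 and the rest c3 - c2 + 1 must be a
       coin: it is above 1 and below c3. *)
    have E3 : c3 = c2 + c2 - 1.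
      have E : c3 + c3 = c3 - c2 + 1 + c4 by lia.
      have := two c3 c3 c4 _ _ _ E.
      rewrite !inE !eqxx !orbT !low5 ?greedy_head; [|lia..].
      by move=> /(_ isT isT erefl); lia.
    have -> : greedy [:: c4; c3; c2; 1] (x + d) = c2.
      rewrite (g4_c4 _ (c2 - 2 + c2)); [|lia|lia].
      by rewrite (g2_step _ _ erefl) g2_low; lia.
    have [dE|dE|dE] := dS.
    - rewrite (g4_c3 _ (c2 - 2)) ?g2_low; lia.
    - rewrite (g4_c4 _ (c2 - 2)) ?g2_low; lia.
    - rewrite (g4_c4 _ (c2 - 3 + c2)); [|lia|lia].
      by rewrite (g2_step _ _ erefl) g2_low; lia.
  (* Now c4 = 2 c3 - 1 and c5 = 3 c3 - 2 = c4 + (c3 - 1). *)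
  rewrite (g4_c4 (x + d) (c3 - 1)); [|lia|lia].
  have [dE|dE|dE] := dS.
  - rewrite (g4_c3 _ (c3 - 2)); [|lia..].
    by have := sub2 (c3 - 2); rewrite (_ : (c3 - 2).+1 = c3 - 1); lia.
  - rewrite (g4_c4 _ (c3 - 1 - c2)); [|lia..].
    by rewrite (g2_step _ (c3 - 1 - c2)); lia.
  - rewrite (g4_c4 _ (c3 - 2)); [|lia..].
    by have := sub2 (c3 - 2); rewrite (_ : (c3 - 2).+1 = c3 - 1); lia.
(* Here 2 c4 = c5 + c3, since 2 c4 = c5 + c2 would give c3 = c4. *)
have E4 : c4 = 2 * c3 - c2 by lia.
have E5 : c5 = 3 * c3 - 2 * c2 by lia.
(* If c3 < 2 c2, greedy takes c5 from 2 c3 and leaves a positive rest below c2, which must be 1. *)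
have c3_ge : 2 * c2 <= c3 + 1.
  have [|lt] := leqP (2 * c2) c3; first lia.
  have E : c3 + c3 = 2 * c2 - c3 + c5 by lia.
  have := two c3 c3 c5 _ _ _ E (step5 _).
  by rewrite !inE !eqxx !orbT => /(_ isT isT); lia.
(* The offset t is below c2. The coin c3 or c4 is missing from x only when t = 0 and c3 = 2 c2 -
   1. *)
set t := x + d - c5.
rewrite (g4_c4 (x + d) (c3 - c2 + t)); [|lia..].
have [dE|dE|dE] := dS.
- have [le|lt] := leqP (2 * c2) (c3 + t).
    rewrite (g4_c3 _ (c3 + t - 2 * c2)); [|lia..].
    by rewrite (g2_step _ (c3 + t - 2 * c2)); lia.
  have t0 : t = 0 by lia.
  rewrite g4_low; last lia.
  rewrite t0 (g2_step x (x - c2)) ?g2_low; lia.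
- have [le|lt] := leqP (2 * c2) (c3 + t).
    rewrite (g4_c4 _ (c3 + t - 2 * c2)); [|lia..].
    by rewrite (g2_step _ (c3 + t - 2 * c2)); lia.
  rewrite (g4_c3 _ (c2 - 2)); [|lia..].
  rewrite !g2_low; lia.
- rewrite (g4_c4 _ (c3 - c2 + t - 1)); [|lia..].
  have := sub2 (c3 - c2 + t - 1).
  by rewrite (_ : (c3 - c2 + t - 1).+1 = c3 - c2 + t); lia.
Qed.

Lemma special_subadditive (c : nat) :
  3 < c -> subadditive_on [:: 2 * c; c + 1; c; 2; 1].
Proof.
move=> c3 x d.
(* The greedy size of a remainder below 2c: the coin c is used only for r = c, since c + 1 is taken
   from anything larger. *)
pose f r := if r < c then uphalf r else if r == c then 1 else (uphalf (r - c - 1)).+1.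
have gE q r : r < 2 * c -> greedy [:: 2 * c; c + 1; c; 2; 1] (q * (2 * c) + r) = q + f r.
  move=> rc; rewrite greedy_divn //; congr (_ + _).
  have u2 y : greedy [:: 2; 1] y = uphalf y by rewrite /=; lia.
  rewrite /f; have [rlt|rge] := ltnP r c.
    by rewrite (greedy_small (c + 1)) ?(greedy_small c) ?u2 //; lia.
  have [->|rn] := eqVneq r c.
    rewrite greedy_small -{2}[c]add0n ?greedy_head ?greedy0 //; lia.
  rewrite -{1}(@subnK (c + 1) r); last lia.
  rewrite greedy_head ?(greedy_small (c + 1)) ?(greedy_small c) ?u2; lia.
set q := x %/ (2 * c); set r := x %% (2 * c).
have rc : r < 2 * c by rewrite ltn_mod; lia.
have xE : x = q * (2 * c) + r := divn_eq x (2 * c).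
rewrite xE gE // !inE => dS.
(* Either d stays within the block of length 2c, or it carries into the next one. *)
have [lt|ge] := ltnP (r + d) (2 * c).
  rewrite -addnA gE //; rewrite /f; do !case: ifP; lia.
rewrite (_ : _ + d = q.+1 * (2 * c) + (r + d - 2 * c)); last by rewrite mulSn; lia.
rewrite gE; last lia.
rewrite /f; do !case: ifP; lia.
Qed.

Theorem theorem10 (c2 c3 c4 c5 : nat) :
  1 < c2 -> c2 < c3 -> c3 < c4 -> c4 < c5 ->
  (~ canonical_system [tuple 1; c2; c3; c4] /\
   canonical_system [tuple 1; c2; c3; c4; c5]) <->
  (3 < c3 /\
   [tuple 1; c2; c3; c4; c5] = [tuple 1; 2; c3; c3 + 1; 2 * c3]).
Proof.
move=> h2 h3 h4 h5.
have sys4 : coin_system [tuple 1; c2; c3; c4] by rewrite /coin_system /=; lia.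
have sys5 : coin_system [tuple 1; c2; c3; c4; c5] by rewrite /coin_system /=; lia.
have can4 := canonicalP _ _ sys4; have can5 := canonicalP _ _ sys5.
split=> [[ncan4 /can5 sub5]|[c33 /(congr1 val) /= [E2 E4 E5]]].
  have [//|c33 -> -> ->] := special_of_noncanonical_prefix c2 c3 c4 c5 h2 h3 h4 h5 sub5 _.
    by move=> sub4; apply: ncan4; apply/can4.
  by split; last exact: val_inj.
split; last by apply/can5; rewrite E2 E4 E5; exact: special_subadditive.
(* The counterexample is c3 + c3: greedy takes c3 + 1 and leaves c3 - 1 >= 3, which costs at least
   two more coins. *)
move=> /can4 sub4; have : c3 \in rev [tuple 1; c2; c3; c4] by rewrite !inE eqxx !orbT.
move=> /(sub4 c3); apply/negP; rewrite E2 E4 -ltnNge.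
have -> : greedy [:: c3 + 1; c3; 2; 1] c3 = 1.
  by rewrite greedy_small -{2}[c3]add0n ?greedy_head ?greedy0 //; lia.
rewrite -(@subnK (c3 + 1) (c3 + c3)); last lia.
rewrite greedy_head ?(greedy_small (c3 + 1)) ?(greedy_small c3); [|lia..].
by rewrite /=; lia.
Qed.
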